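(* Let $k\ge 2$ be an integer and let $\Gamma$ be a connected bipartite $k$-regular graph with $v$ vertices and biadjacency matrix $\boldsymbol{N}$. Let $\{\pm\tau_0,\ldots,\pm\tau_d\}$ be the set of distinct eigenvalues of the adjacency matrix of $\Gamma$, where $\tau_0=k$ and the $\tau_i\ge 0$ are distinct. Suppose there exists a real polynomial $f(x)=\sum_{i=0}^{t} f_i\,\mathscr{F}_{0,i}(x)$ such that $f(k^2)>0$, $f(\tau_i^2)\le 0$ for each $i\in\{1,\ldots,d\}$, $f_0>0$, and $f_j\ge 0$ for each $j\in\{1,\ldots,t\}$. Then $$v\le \frac{2f(k^2)}{f_0}.$$ Equality holds if and only if $f(\tau_i^2)=0$ for each $i\in\{1,\ldots,d\}$ and, for each $j\in\{1,\ldots,t\}$, $\mathrm{tr}(f_j\mathscr{F}_{0,j}(\boldsymbol{N}\boldsymbol{N}^{\top}))=0$ and $\mathrm{tr}(f_j\mathscr{F}_{0,j}(\boldsymbol{N}^{\top}\boldsymbol{N}))=0$. If equality holds and $f_j>0$ for each $j\in\{1,\ldots,t\}$, then the girth of $\Gamma$ is at least $2t+2$.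
   Context: Graphs are finite and simple. For a connected regular bipartite graph, the adjacency matrix can be written (ordering vertices by the two colour classes) as $\boldsymbol{A}=\begin{pmatrix}\boldsymbol{O}&\boldsymbol{N}\\ \boldsymbol{N}^{\top}&\boldsymbol{O}\end{pmatrix}$; the matrix $\boldsymbol{N}$ is called the biadjacency matrix. For the integer $k\ge 2$ define polynomials $F_i(x)=F_i^{(k)}(x)$ by $F_0(x)=1$, $F_1(x)=x$, $F_2(x)=x^2-k$, and $F_i(x)=xF_{i-1}(x)-(k-1)F_{i-2}(x)$ for $i\ge 3$. The polynomial $F_{2i}$ is even, and $\mathscr{F}_{0,i}$ denotes the polynomial of degree $i$ with $\mathscr{F}_{0,i}(x^2)=F_{2i}(x)$. Thus $\mathscr{F}_{0,0}(x)=1$, $\mathscr{F}_{0,1}(x)=x-k$, $\mathscr{F}_{0,2}(x)=x^2-(3k-2)x+k(k-1)$, and $\mathscr{F}_{0,i}(x)=(x-2k+2)\mathscr{F}_{0,i-1}(x)-(k-1)^2\mathscr{F}_{0,i-2}(x)$ for $i\ge 3$. *)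

(* Defs.v *)
From HB Require Import structures.
From mathcomp Require Import all_boot all_order all_algebra.
From mathcomp Require Import reals ring.

Set Implicit Arguments.
Unset Strict Implicit.
Unset Printing Implicit Defensive.

Import Order.TTheory GRing.Theory Num.Theory.
Local Open Scope ring_scope.

Section Graphs.

Variables (V : finType) (e : rel V).

Definition connected_graph : Prop := forall x y : V, connect e x y.

Definition regular_graph (k : nat) : Prop :=
  forall x : V, #|[set y | e x y]| = k.

Definition bipartition (U : {set V}) : Prop :=
  forall x y : V, e x y -> (x \in U) != (y \in U).

(* The bound on the size excludes [:: x; y], for which [ucycle] traverses
   the edge xy twice. *)
Definition graph_cycle (s : seq V) : Prop := ucycle e s /\ (2 < size s)%N.

Definition is_girth (g : nat) : Prop :=
  (exists2 s, graph_cycle s & size s = g) /\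
  (forall s, graph_cycle s -> (g <= size s)%N).

Variable R : realType.

Definition adjacency_mx : 'M[R]_#|V| :=
  \matrix_(i, j) (e (enum_val i) (enum_val j))%:R.

Definition biadjacency_mx (U : {set V}) : 'M[R]_(#|U|, #|~: U|) :=
  \matrix_(i, j) (e (enum_val i) (enum_val j))%:R.

End Graphs.

(* [horner_mx] requires a dimension of the form n.+1, which #|U| is not. *)
Definition eval_mx (R : realType) (n : nat) (p : {poly R}) (A : 'M[R]_n) :
  'M[R]_n := \sum_(i < size p) p`_i *: A ^+ i.

Lemma eval_mxE (R : realType) (n : nat) (p : {poly R}) (A : 'M[R]_n.+1) :
  eval_mx p A = horner_mx A p.
Proof.
rewrite -{2}[p]coefK poly_def rmorph_sum; apply: eq_bigr => i _ /=.
by rewrite horner_mxZ rmorphXn /= horner_mx_X.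
Qed.

Section Polynomials.

Variables (R : realType) (k : nat).

Fixpoint F (i : nat) : {poly R} :=
  match i with
  | 0 => 1
  | i1.+1 =>
    match i1 with
    | 0 => 'X
    | i2.+1 =>
      if i2 is 0 then 'X^2 - k%:R%:P
      else 'X * F i1 - (k%:R - 1)%:P * F i2
    end
  end.

(* [even_poly] keeps the coefficients of even index: F_(2i) being even,
   this is the polynomial calF with calF(x^2) = F_(2i)(x). *)
Definition calF0 (i : nat) : {poly R} := even_poly (F i.*2).

Lemma F_rec i :
  F i.+3 = 'X * F i.+2 - (k%:R - 1)%:P * F i.+1.
Proof. by []. Qed.

Lemma F_parity i : odd_poly (F i.*2) = 0 /\ even_poly (F i.*2.+1) = 0.
Proof.
have X0 : even_poly ('X : {poly R}) = 0.
  by rewrite -['X]mul1r even_polyMX -polyC1 odd_polyC mul0r.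
have XX : odd_poly ('X ^+ 2 : {poly R}) = 0 by rewrite expr2 odd_polyMX X0.
elim: i => [|i [IHo IHe]]; first by rewrite /= X0 -polyC1 odd_polyC.
have Ho : odd_poly (F i.+1.*2) = 0.
  case: i IHo IHe => [_ _|i IHo IHe].
    by rewrite [F _]/= linearB /= XX odd_polyC subr0.
  rewrite doubleS F_rec mul_polyC mulrC linearB linearZ /=.
  by rewrite odd_polyMX IHe IHo scaler0 subr0.
split=> //; rewrite doubleS F_rec mul_polyC mulrC linearB linearZ /=.
by rewrite even_polyMX Ho IHe mul0r scaler0 subr0.
Qed.

Lemma calF0_comp i : calF0 i \Po 'X^2 = F i.*2.
Proof.
rewrite -[RHS]poly_even_odd (proj1 (F_parity i)).
by rewrite comp_poly0 mul0r addr0.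
Qed.

Lemma calF0_0 : calF0 0 = 1.
Proof. by rewrite /calF0 /= -polyC1 even_polyC. Qed.

Lemma calF0_1 : calF0 1 = 'X - k%:R%:P.
Proof.
rewrite /calF0 [F _]/= linearB /= even_polyC expr2 even_polyMX.
by rewrite -{1}['X]mul1r odd_polyMX -polyC1 even_polyC mul1r.
Qed.

Lemma even_poly_F i : even_poly (F i.+3) =
  odd_poly (F i.+2) * 'X - (k%:R - 1)%:P * even_poly (F i.+1).
Proof.
rewrite F_rec; move: (F i.+2) (F i.+1) => p q.
by rewrite !mul_polyC mulrC linearB linearZ /= even_polyMX.
Qed.

Lemma odd_poly_F i : odd_poly (F i.+3) =
  even_poly (F i.+2) - (k%:R - 1)%:P * odd_poly (F i.+1).
Proof.
rewrite F_rec; move: (F i.+2) (F i.+1) => p q.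
by rewrite !mul_polyC mulrC linearB linearZ /= odd_polyMX.
Qed.

Lemma calF0_2 :
  calF0 2 = 'X^2 - (3 * k%:R - 2)%:P * 'X + (k%:R * (k%:R - 1))%:P.
Proof.
have o1 : odd_poly (F 1) = 1.
  by rewrite /= -['X]mul1r odd_polyMX -polyC1 even_polyC.
rewrite /calF0 (even_poly_F 1) (odd_poly_F 0) o1 -[even_poly _]/(calF0 1).
by rewrite calF0_1 !(polyCB, polyCM, polyCMn); ring.
Qed.

Lemma calF0_rec i : calF0 i.+3 =
  ('X - (2 * k%:R - 2)%:P) * calF0 i.+2 - ((k%:R - 1) ^+ 2)%:P * calF0 i.+1.
Proof.
rewrite /calF0 !doubleS.
have h1 := even_poly_F i.*2.+1; have h2 := even_poly_F i.*2.+3.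
have h3 := odd_poly_F i.*2.+2; move: h1 h2 h3.
move: (even_poly (F i.*2.+2)) (even_poly (F i.*2.+4)) => a b.
move: (even_poly (F i.*2.+3.+3)) (odd_poly (F i.*2.+3)) => c o -> -> ->.
by rewrite !(polyCB, polyCM, polyCMn, polyC_exp); ring.
Qed.

End Polynomials.

(* Main.v *)
(* Write A for the adjacency matrix.  The entry (x, y) of F_i(A) counts the
   nonbacktracking walks of length i from x to y, so every F_i(A) is
   nonnegative, and the diagonal blocks of F_2j(A) are calF_0,j(N N^T) and
   calF_0,j(N^T N).  Evaluate tr f(A^2) twice.  Expanding f gives c_0 v plus the
   nonnegative terms c_j tr F_2j(A).  Expanding over the spectrum gives 2 f(k^2)
   plus the nonpositive terms f(tau_i^2), because k and -k are simple
   eigenvalues of a connected regular bipartite graph.  Equality kills all these terms;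
   then, if every c_j is positive, there is no closed nonbacktracking walk of
   length 2j <= 2t, hence no cycle of such a length, and all cycles are even. *)

Require Import Defs.
From mathcomp Require Import all_boot all_order all_algebra.
From mathcomp Require Import reals.
From mathcomp Require Import ring complex spectral.

Set Implicit Arguments.
Unset Strict Implicit.
Unset Printing Implicit Defensive.

Import Order.TTheory GRing.Theory Num.Theory.
Local Open Scope ring_scope.

(** * Spectrum of a real symmetric matrix *)

(** Writing the matrix as a sum of rank-one matrices bounds the rank from above. The reverse
    inequality applies that same bound to the indicator [z] of the zeros of [d], because the
    identity is a multiple of [diag_mx d] plus [diag_mx z]. *)
Lemma mxrank_diag (K : fieldType) n (d : 'rV[K]_n) :
  \rank (diag_mx d) = #|[set i | d 0 i != 0]|.
Proof.
have upper (c : 'rV[K]_n) : (\rank (diag_mx c) <= #|[set i | c 0%R i != 0%R]|)%N.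
  have -> : diag_mx c = \sum_(i in [set i | c 0 i != 0]) c 0 i *: delta_mx i i.
    rewrite diag_mx_sum_delta [RHS]big_mkcond /=; apply: eq_bigr => i _.
    by rewrite inE; case: eqP => [->|] //=; rewrite scale0r.
  rewrite -sum1_card; elim/big_ind2: _ => [|m1 A1 m2 A2 h1 h2|i _].
  - by rewrite mxrank0.
  - exact: leq_trans (mxrank_add _ _) (leq_add h1 h2).
  - by rewrite (leq_trans (mxrank_scale _ _)) // mxrank_delta.
apply/eqP; rewrite eqn_leq upper /=.
pose z := \row_i ((d 0 i == 0)%:R : K); pose b := \row_i (d 0 i)^-1.
have E : 1%:M = diag_mx d *m diag_mx b + diag_mx z.
  rewrite -diag_const_mx mulmx_diag -raddfD; congr diag_mx.
  apply/rowP => i; rewrite !mxE; case: eqP => [->|/eqP h].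
    by rewrite mul0r add0r.
  by rewrite divff // addr0.
have : (n <= \rank (diag_mx d) + #|[set i | z 0%R i != 0%R]|)%N.
  rewrite -{1}(mxrank1 K n) E (leq_trans (mxrank_add _ _)) //.
  exact: leq_add (mxrankM_maxl _ _) (upper z).
have -> : [set i | z 0 i != 0] = ~: [set i | d 0 i != 0].
  by apply/setP => i; rewrite !inE mxE; have [/eqP h|/negPf h] := boolP (d 0 i == 0);
     rewrite ?h ?eqxx ?oner_eq0.
rewrite -[X in (X <= _)%N -> _]card_ord -(cardsC [set i | d 0 i != 0]).
by rewrite leq_add2r.
Qed.

(** Over the complex numbers the matrix is Hermitian, hence unitarily diagonalizable with real
    eigenvalues. [D] lists them with multiplicity: the first clause is the spectral trace formula,
    the second equates geometric multiplicity with the number of occurrences. *)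
Lemma symmetric_mx_spectrum (R : realType) n (A : 'M[R]_n) : A^T = A ->
  exists D : 'I_n -> R,
    (forall p, \tr (eval_mx p A) = \sum_i p.[D i]) /\
    (forall a, \rank (eigenspace A a) = #|[set i | D i == a]|).
Proof.
case: n A => [|n] A As.
  exists (fun=> 0); split=> [p|a]; first by rewrite /mxtrace !big_ord0.
  have -> : eigenspace A a = 0 by apply/matrixP => -[].
  by rewrite mxrank0; apply/esym/eq_card0 => -[].
pose iota : {rmorphism R -> R[i]} := real_complex R.
pose B : 'M[R[i]]_n.+1 := map_mx iota A.
have Breal : B \is a mxOver Num.real.
  by apply/mxOverP => i j; rewrite mxE; apply/complex_realP; exists (A i j).
have Bsym : B \is symmetricmx.
  by apply/is_hermitianmxP; rewrite expr0 scale1r map_mx_id // map_trmx As.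
have Bherm := realsym_hermsym Bsym Breal.
have /orthomx_spectralP := hermitian_normalmx Bherm.
have Pu := spectral_unit B; have Dreal := hermitian_spectral_diag_real Bherm.
move: (spectralmx B) (spectral_diag B) Pu Dreal => P d Pu Dreal EB.
pose D i := complex.Re (d 0 i).
have ED i : d 0 i = iota (D i) by rewrite /D /= RRe_real //; apply: (mxOverP Dreal).
exists D; split=> [p|a].
  apply: (@complexI R); rewrite eval_mxE.
  rewrite -[LHS]/(iota _) -[RHS]/(iota _) -trace_map_mx [RHS]rmorph_sum.
  rewrite map_horner_mx -/B EB horner_mx_uconjC //.
  rewrite mxtrace_mulC mulmxA mulmxV // mul1mx.
  rewrite horner_mx_diag mxtrace_diag; apply: eq_bigr => i _.
  by rewrite mxE ED -horner_map.
(* The eigenspace is the kernel of [A - a], whose rank survives both the field extension and the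
   conjugation by [P]. *)
rewrite /eigenspace mxrank_ker -(mxrank_map iota).
rewrite map_mxB map_scalar_mx -/B EB.
have -> : invmx P *m diag_mx d *m P - (iota a)%:M =
    invmx P *m diag_mx (d - const_mx (iota a)) *m P.
  by rewrite raddfB /= diag_const_mx mulmxBr mulmxBl scalar_mxC mulmxKV //.
rewrite mxrankMfree ?row_free_unit //.
rewrite eqmxMfull ?row_full_unit ?unitmx_inv // mxrank_diag.
rewrite -[X in (X - _)%N]card_ord.
have -> : [set i | (d - const_mx (iota a)) 0 i != 0] = ~: [set i | D i == a].
  apply/setP => i; rewrite !inE !mxE ED subr_eq0.
  by rewrite (inj_eq (@complexI R)).
by rewrite -(cardsC [set i | D i == a]) addnK.
Qed.

(** * Evaluating polynomials at matrices *)

Section EvalMx.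
Variables (R : realType) (n : nat) (A : 'M[R]_n).

Lemma eval_mxB p q : eval_mx (p - q) A = eval_mx p A - eval_mx q A.
Proof.
case: n A => [|m] B; first by apply/matrixP => -[].
by rewrite !eval_mxE rmorphB.
Qed.

Lemma eval_mxZ a p : eval_mx (a *: p) A = a *: eval_mx p A.
Proof.
case: n A => [|m] B; first by apply/matrixP => -[].
by rewrite !eval_mxE horner_mxZ.
Qed.

Lemma eval_mx_sum (I : Type) (r : seq I) (P : pred I) (F : I -> {poly R}) :
  eval_mx (\sum_(i <- r | P i) F i) A = \sum_(i <- r | P i) eval_mx (F i) A.
Proof.
case: n A => [|m] B; first by apply/matrixP => -[].
by rewrite eval_mxE rmorph_sum; apply: eq_bigr => i _; rewrite eval_mxE.
Qed.

Lemma eval_mxM p q : eval_mx (p * q) A = eval_mx p A *m eval_mx q A.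
Proof.
case: n A => [|m] B; first by apply/matrixP => -[].
by rewrite !eval_mxE rmorphM.
Qed.

Lemma eval_mxC a : eval_mx a%:P A = a%:M.
Proof.
case: n A => [|m] B; first by apply/matrixP => -[].
by rewrite eval_mxE horner_mx_C.
Qed.

Lemma eval_mxX : eval_mx 'X A = A.
Proof.
case: n A => [|m] B; first by apply/matrixP => -[].
by rewrite eval_mxE horner_mx_X.
Qed.

Lemma eval_mxXn i : eval_mx 'X^i A = A ^+ i.
Proof.
elim: i => [|i IH]; first by rewrite expr0 -polyC1 eval_mxC.
by rewrite exprS eval_mxM eval_mxX IH exprS.
Qed.

End EvalMx.

Lemma eval_mx_comp_sqr (R : realType) n (A : 'M[R]_n) (p : {poly R}) :
  eval_mx (p \Po 'X^2) A = eval_mx p (A *m A).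
Proof.
rewrite comp_polyE eval_mx_sum; apply: eq_bigr => i _.
by rewrite eval_mxZ -exprM eval_mxXn exprM.
Qed.

(** Rows indexed by the image of [f] are supported on that image, so a product computed inside the
    submatrix misses no nonzero term. This serves to pass from the square of the adjacency matrix to
    its diagonal blocks. *)
Lemma eval_mx_mxsub (R : realType) m n (f : 'I_m -> 'I_n) (B : 'M[R]_n)
    (p : {poly R}) :
  injective f -> (forall i l, B (f i) l != 0 -> l \in codom f) ->
  eval_mx p (mxsub f f B) = mxsub f f (eval_mx p B).
Proof.
move=> f_inj f_stab.
have powB r : mxsub f f B ^+ r = mxsub f f (B ^+ r).
  elim: r => [|r IH].
    by rewrite !expr0; apply/matrixP => i j; rewrite !mxE (inj_eq f_inj).
  rewrite !exprS IH; apply/matrixP => i j; rewrite !mxE.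
  rewrite (bigID [in [set f x | x in 'I_m]]) /= [X in _ + X]big1 ?addr0.
    rewrite big_imset; last by move=> x y _ _; apply: f_inj.
    by apply: eq_bigr => l _; rewrite !mxE.
  move=> l; apply: contraNeq; rewrite mulf_eq0 negb_or => /andP[/f_stab].
  by case/codomP => l' -> _; apply: imset_f.
rewrite /eval_mx raddf_sum /=; apply: eq_bigr => r _.
by rewrite powB; apply/matrixP => i j; rewrite !mxE.
Qed.

(** * Nonbacktracking walks *)

Section Walks.
Variables (V : finType) (e : rel V).

(** Counts nonbacktracking walks of length [i.+1] from [x] to [y] whose first step is the arc from
    [x] to [z]. The first arc is recorded because it restricts the next step. *)
Fixpoint arc_nbwalks (i : nat) (x z y : V) : nat :=
  if i is j.+1 then (e x z * \sum_(w | w != x) arc_nbwalks j z w y)%N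
  else (e x z * (z == y))%N.

Definition nbwalks (i : nat) (x y : V) : nat :=
  if i is j.+1 then (\sum_z arc_nbwalks j x z y)%N else (x == y).

Lemma arc_nbwalks_arc i x z y :
  (e x z * arc_nbwalks i x z y = arc_nbwalks i x z y)%N.
Proof. by case: i => [|i] /=; rewrite mulnA mulnb andbb. Qed.

(** A nonbacktracking walk from [z] can be prefixed by the arc from [x] to [z] unless its own first
    step returns to [x]. *)
Lemma arc_nbwalksS i x z y :
  (arc_nbwalks i.+1 x z y + e x z * arc_nbwalks i z x y =
   e x z * nbwalks i.+1 z y)%N.
Proof. by rewrite /= -mulnDr addnC [in RHS](bigD1 x). Qed.

Section Regular.
Variable (k : nat).
Hypotheses (e_sym : symmetric e) (e_reg : regular_graph e k).

Lemma sum_adj x (a : nat) : (\sum_z e x z * a = k * a)%N.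
Proof.
rewrite -big_distrl /= -(e_reg x) -sum1_card.
congr (_ * _)%N; rewrite [RHS]big_mkcond.
by apply: eq_bigr => z _; rewrite inE; case: (e x z).
Qed.

Lemma nbwalks1 x y : nbwalks 1 x y = e x y.
Proof.
rewrite /= (bigD1 y) //= eqxx muln1 big1 ?addn0 // => z /negPf ->.
by rewrite muln0.
Qed.

Lemma nbwalks_step i x y :
  (nbwalks i.+2 x y + \sum_z e x z * arc_nbwalks i z x y =
   \sum_z e x z * nbwalks i.+1 z y)%N.
Proof. by rewrite -big_split; apply: eq_bigr => z _; apply: arc_nbwalksS. Qed.

(** The backtracking walks of length 2 are the [k] closed walks through a neighbour of [x]; hence
    the constant [k] in [F 2], where later degrees have [k - 1]. *)
Lemma nbwalks2 x y :
  (nbwalks 2 x y + k * (x == y) = \sum_z e x z * e z y)%N.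
Proof.
transitivity (\sum_z e x z * nbwalks 1 z y)%N; last first.
  by apply: eq_bigr => z _; rewrite nbwalks1.
rewrite -nbwalks_step -(sum_adj x); congr (_ + _)%N.
by apply: eq_bigr => z _; rewrite /= (e_sym z x); case: (e x z); rewrite ?mul1n.
Qed.

(** A walk of length [i.+1] from [x] is preceded by a step out to a neighbour and back; every
    neighbour except the first vertex of that walk gives a walk to be discarded, hence the factor
    [k - 1]. The term is split between the two sides to avoid subtraction in [nat]. *)
Lemma nbwalks_rec i x y :
  (nbwalks i.+3 x y + k * nbwalks i.+1 x y =
   \sum_z e x z * nbwalks i.+2 z y + nbwalks i.+1 x y)%N.
Proof.
rewrite -nbwalks_step -addnA; congr (_ + _)%N.
rewrite -(sum_adj x) {2}/nbwalks -big_split; apply: eq_bigr => z _.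
rewrite -(arc_nbwalks_arc i).
have /(congr1 (muln (e x z))) := arc_nbwalksS i z x y.
by rewrite (e_sym z x); case: (e x z); rewrite ?mul1n ?mul0n.
Qed.

End Regular.
End Walks.

(** * Walk counts as polynomials in the adjacency matrix *)

Section WalkMatrices.
Variables (R : realType) (V : finType) (e : rel V) (k : nat).
Hypotheses (e_sym : symmetric e) (e_reg : regular_graph e k).

Lemma sum_enum_val (W : nmodType) (S : {pred V}) (G : V -> W) :
  \sum_(i < #|S|) G (enum_val i) = \sum_(x in S) G x.
Proof. by rewrite [RHS]big_enum_val. Qed.

Definition count_mx (M : V -> V -> nat) : 'M[R]_#|V| :=
  \matrix_(i, j) (M (enum_val i) (enum_val j))%:R.

Lemma adjacency_mul_count (M : V -> V -> nat) :
  adjacency_mx e R *m count_mx M =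
  count_mx (fun x y => \sum_z e x z * M z y)%N.
Proof.
apply/matrixP => i j; rewrite !mxE natr_sum -(sum_enum_val predT).
by apply: eq_bigr => l _; rewrite !mxE natrM.
Qed.

(** Both sides satisfy the same three-term recurrence. It holds only from degree 3 on, so degrees 0,
    1 and 2 are checked separately and the induction carries two consecutive degrees. *)
Lemma eval_mx_F i :
  eval_mx (F R k i) (adjacency_mx e R) = count_mx (nbwalks e i).
Proof.
have eqM M M' : (forall x y, M x y = M' x y) -> count_mx M = count_mx M'.
  by move=> E; apply/matrixP => a b; rewrite !mxE E.
have F0 : eval_mx (F R k 0) (adjacency_mx e R) = count_mx (nbwalks e 0).
  rewrite /= -polyC1 eval_mxC; apply/matrixP => a b.
  by rewrite !mxE /= (inj_eq enum_val_inj).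
have F1 : eval_mx (F R k 1) (adjacency_mx e R) = count_mx (nbwalks e 1).
  rewrite eval_mxX; apply: (eqM (fun x y => e x y : nat)) => x y.
  by rewrite nbwalks1.
have F2 : eval_mx (F R k 2) (adjacency_mx e R) = count_mx (nbwalks e 2).
  rewrite [F _ _ _]/= eval_mxB expr2 eval_mxM eval_mxX eval_mxC.
  rewrite (adjacency_mul_count (fun x y => e x y : nat)).
  apply/matrixP => a b; rewrite !mxE -(nbwalks2 e_sym e_reg) natrD natrM.
  by rewrite (inj_eq enum_val_inj) mulr_natr addrK.
case: i => [//|i]; suff [] : eval_mx (F R k i.+1) (adjacency_mx e R) =
    count_mx (nbwalks e i.+1) /\
  eval_mx (F R k i.+2) (adjacency_mx e R) = count_mx (nbwalks e i.+2) by [].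
elim: i => [//|i [IH1 IH2]]; split=> //.
rewrite F_rec eval_mxB !eval_mxM eval_mxX eval_mxC IH1 IH2.
rewrite adjacency_mul_count mul_scalar_mx; apply/matrixP => a b.
have := nbwalks_rec e_sym e_reg i (enum_val a) (enum_val b).
move/(congr1 (fun m => m%:R : R)); rewrite !natrD natrM => E.
rewrite !mxE mulrBl mul1r.
apply: (addIr (k%:R * (nbwalks e i.+1 (enum_val a) (enum_val b))%:R)).
by rewrite E opprB addrA subrK.
Qed.

(** [B *m B^T] is the diagonal block on [S] of the squared adjacency matrix, and that square does
    not mix the colour classes. Keeping [T] with an equation, rather than writing [~: S], lets the
    lemma apply to [~: U] with [T] equal to [U] itself. *)
Lemma trace_eval_biadjacency (S T : {set V}) (j : nat) :
  T = ~: S -> bipartition e S ->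
  let B : 'M[R]_(#|S|, #|T|) :=
    \matrix_(a, b) (e (enum_val a) (enum_val b))%:R in
  \tr (eval_mx (calF0 R k j) (B *m B^T)) =
  \sum_(x in S) (nbwalks e j.*2 x x)%:R.
Proof.
move=> ET S_bip B; pose g (a : 'I_#|S|) := enum_rank (enum_val a).
have sqrA a b : (adjacency_mx e R *m adjacency_mx e R) a b =
    \sum_z (e (enum_val a) z)%:R * (e z (enum_val b))%:R.
  by rewrite !mxE -(sum_enum_val predT); apply: eq_bigr => l _; rewrite !mxE.
have -> : B *m B^T = mxsub g g (adjacency_mx e R *m adjacency_mx e R).
  apply/matrixP => a b; rewrite [RHS]mxE sqrA !enum_rankK mxE.
  transitivity (\sum_(z in T) (e (enum_val a) z)%:R * (e z (enum_val b))%:R : R).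
    rewrite -sum_enum_val; apply: eq_bigr => l _.
    by rewrite !mxE (e_sym (enum_val b)).
  rewrite big_mkcond; apply: eq_bigr => z _.
  rewrite ET inE; case: ifP => // /negbFE zS.
  case E: (e _ z); last by rewrite mul0r.
  by have := S_bip _ _ E; rewrite zS (enum_valP a).
rewrite eval_mx_mxsub; first last.
- move=> a l; rewrite sqrA => nz.
  (* Two steps along edges lead from [S] back to [S]. *)
  have lS : enum_val l \in S.
    apply: contraNT nz => lS; apply/eqP; apply: big1 => z _.
    case E1: (e _ z); last by rewrite mul0r.
    case E2: (e z _); last by rewrite mulr0.
    have := S_bip _ _ E1; have := S_bip _ _ E2.
    by rewrite enum_rankK (negPf lS) (enum_valP a); case: (z \in S).
  apply/codomP; exists (enum_rank_in lS (enum_val l)).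
  by rewrite /g enum_rankK_in // enum_valK.
- by move=> a b /enum_rank_inj /enum_val_inj.
rewrite -eval_mx_comp_sqr calF0_comp eval_mx_F -sum_enum_val.
by apply: eq_bigr => a _; rewrite !mxE !enum_rankK.
Qed.

Lemma trace_eval_F i :
  \tr (eval_mx (F R k i) (adjacency_mx e R)) = \sum_x (nbwalks e i x x)%:R.
Proof.
rewrite eval_mx_F -(sum_enum_val predT).
by apply: eq_bigr => a _; rewrite !mxE.
Qed.

(** * Simplicity of the eigenvalues [k] and [-k] *)

Hypothesis e_conn : connected_graph e.

(* [\sum_(x ~ y) (u x - s * u y) ^+ 2 = 2 * k * |u|^2 - 2 * s * <u, u *m A>]
   vanishes, so [u] is constant up to sign along every edge. *)
Lemma eigenvector_edge (s : R) (u : 'rV[R]_#|V|) :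
  s ^+ 2 = 1 -> u *m adjacency_mx e R = (s * k%:R) *: u ->
  forall x y, e x y -> u 0 (enum_rank x) = s * u 0 (enum_rank y).
Proof.
move=> s2 uA; pose v x := u 0 (enum_rank x).
have vA y : \sum_x v x * (e x y)%:R = s * k%:R * v y.
  have /rowP/(_ (enum_rank y)) := uA; rewrite !mxE => <-.
  rewrite -(sum_enum_val predT); apply: eq_bigr => l _.
  by rewrite !mxE enum_rankK /v enum_valK.
have deg x : \sum_y (e x y)%:R = k%:R :> R.
  by have := sum_adj e_reg x 1; rewrite muln1 => <-; rewrite natr_sum;
     apply: eq_bigr => y _; rewrite muln1.
have sum0 : \sum_x \sum_y (e x y)%:R * (v x - s * v y) ^+ 2 = 0.
  have -> : \sum_x \sum_y (e x y)%:R * (v x - s * v y) ^+ 2 =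
     \sum_x \sum_y (e x y)%:R * v x ^+ 2 +
     \sum_x \sum_y (e x y)%:R * v y ^+ 2 -
     \sum_y \sum_x (2 * s * v y) * (v x * (e x y)%:R).
    rewrite [X in _ - X]exchange_big -big_split -sumrB /=.
    apply: eq_bigr => x _; rewrite -big_split -sumrB /=.
    by apply: eq_bigr => y _; rewrite sqrrB exprMn s2; ring.
  have -> : \sum_x \sum_y (e x y)%:R * v x ^+ 2 = \sum_x k%:R * v x ^+ 2.
    by apply: eq_bigr => x _; rewrite -mulr_suml deg.
  have -> : \sum_x \sum_y (e x y)%:R * v y ^+ 2 = \sum_x k%:R * v x ^+ 2.
    rewrite exchange_big; apply: eq_bigr => y _ /=; rewrite -mulr_suml -(deg y).
    by congr (_ * _); apply: eq_bigr => x _; rewrite e_sym.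
  rewrite -big_split -sumrB big1 // => y _ /=; rewrite -mulr_sumr vA.
  rewrite [X in _ - X](_ : _ = 2 * s ^+ 2 * k%:R * v y ^+ 2); last by ring.
  by rewrite s2; ring.
move=> x y exy; apply/eqP; rewrite -subr_eq0 -sqrf_eq0.
have h a b : 0 <= (e a b)%:R * (v a - s * v b) ^+ 2.
  by rewrite mulr_ge0 ?sqr_ge0 ?ler0n.
have /eqP := sum0; rewrite psumr_eq0; last by move=> a _; apply: sumr_ge0.
move/allP/(_ x (mem_index_enum _)); rewrite psumr_eq0 //.
by move/allP/(_ y (mem_index_enum _)); rewrite exy mul1r.
Qed.

(** By the edge relation a zero coordinate propagates along paths, and connectedness reaches every
    vertex. *)
Lemma eigenvector_zero (s : R) (u : 'rV[R]_#|V|) (x0 : V) :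
  s ^+ 2 = 1 -> u *m adjacency_mx e R = (s * k%:R) *: u ->
  u 0 (enum_rank x0) = 0 -> u = 0.
Proof.
move=> s2 uA ux0; have s0 : s != 0 by rewrite -sqrf_eq0 s2 oner_eq0.
have prop x p : path e x p -> u 0 (enum_rank x) = 0 ->
    u 0 (enum_rank (last x p)) = 0.
  elim: p x => //= y p IH x /andP[exy /IH h] ux; apply: h.
  apply/eqP; have := eigenvector_edge s2 uA exy; rewrite ux => /esym/eqP.
  by rewrite mulf_eq0 (negPf s0).
apply/rowP => a; rewrite mxE -[a]enum_valK.
have /connectP[p hp ->] := e_conn x0 (enum_val a); exact: prop.
Qed.

(** Reading off the coordinate at [x0], which is multiplication by [d], is injective on the
    eigenspace and has rank at most 1. *)
Lemma rank_eigenspace (s : R) (x0 : V) : s ^+ 2 = 1 ->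
  (\rank (eigenspace (adjacency_mx e R) (s * k%:R)) <= 1)%N.
Proof.
move=> s2; set E := eigenspace _ _.
pose d : 'cV[R]_#|V| := delta_mx (enum_rank x0) 0.
rewrite -(mxrank_mul_ker E d) [X in (_ + X)%N](_ : _ = 0%N) ?addn0.
  exact: leq_trans (mxrankM_maxr _ _) (rank_leq_col _).
apply/eqP; rewrite mxrank_eq0; apply/eqP/row_matrixP => a; rewrite row0.
have := row_sub a (E :&: kermx d)%MS; rewrite sub_capmx => /andP[/eigenspaceP h1].
move/sub_kermxP/matrixP/(_ 0 0); rewrite [RHS]mxE => h2.
apply: (eigenvector_zero s2 h1 (x0 := x0)).
move: h2; rewrite mxE (bigD1 (enum_rank x0)) //= [X in _ + X]big1 ?addr0.
  by rewrite [d _ _]mxE !eqxx mulr1.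
by move=> b /negPf nb; rewrite [d _ _]mxE nb mulr0.
Qed.

End WalkMatrices.

(** * Cycles *)

Section Cycles.
Variables (V : finType) (e : rel V).

Fixpoint nonbacktracking (x z : V) (p : seq V) : bool :=
  if p is w :: q then (w != x) && nonbacktracking z w q else true.

(** Used with [y] equal to [x] to close a cycle; [y] is kept separate because [x] moves along the
    path in the induction. The last hypothesis excludes the immediate return from [x] to [z] and
    back. *)
Lemma nonbacktracking_rcons x z y p :
  uniq (x :: z :: p) -> y \notin z :: p -> (p == [::] -> y != x) ->
  nonbacktracking x z (rcons p y).
Proof.
elim: p x z => [|w p IH] x z /=; first by move=> _ _ ->.
rewrite !inE !negb_or => /andP[/and3P[_ xw _] /andP[/andP[zw zp] /andP[wp up]]].
move=> /and3P[yz yw yp] _; rewrite eq_sym xw IH //=.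
- by rewrite inE negb_or zw zp wp up.
- by rewrite inE negb_or yw.
Qed.

Lemma arc_nbwalks_gt0 x z p : path e x (z :: p) -> nonbacktracking x z p ->
  (0 < arc_nbwalks e (size p) x z (last z p))%N.
Proof.
elim: p x z => [|w p IH] x z /=; first by rewrite andbT eqxx => ->.
move=> /and3P[-> ezw pw] /andP[wx nb]; rewrite mul1n (bigD1 w) //= addn_gt0.
by rewrite IH //= ezw.
Qed.

Lemma graph_cycle_nbwalks s : graph_cycle e s ->
  exists x, (0 < nbwalks e (size s) x x)%N.
Proof.
case: s => [|x [|z [|w p]]] [] // => /andP[ce us] _; exists x.
rewrite /= (bigD1 z) //= addn_gt0.
have := @arc_nbwalks_gt0 x z (rcons (w :: p) x) ce.
rewrite last_rcons size_rcons => -> //.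
apply: nonbacktracking_rcons => //.
by case/andP: us.
Qed.

(** Colours alternate along a path, so a closed one has even length. *)
Lemma graph_cycle_even (U : {set V}) s :
  bipartition e U -> graph_cycle e s -> ~~ odd (size s).
Proof.
move=> bip [/andP[ce _] _]; case: s ce => [//|x p] ce.
have colour y q : path e y q -> (last y q \in U) = (y \in U) (+) odd (size q).
  elim: q y => [|z q IH] y /=; first by rewrite addbF.
  case/andP=> /bip eyz /IH ->.
  by move: eyz; case: (y \in U); case: (z \in U); case: (odd _).
have := colour x (rcons p x) ce; rewrite last_rcons size_rcons.
by rewrite /=; case: (x \in U); case: (odd _).
Qed.

(* Every neighbour of the end of a longest path lies on the path. *)
Lemma exists_graph_cycle (k : nat) (x0 : V) :
  (2 <= k)%N -> symmetric e -> irreflexive e -> regular_graph e k ->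
  exists s, graph_cycle e s.
Proof.
move=> k2 e_sym e_irr e_reg.
pose P n := [exists s : n.-tuple V, uniq s && sorted e s].
have P1 : exists n, P n by exists 1%N; apply/existsP; exists [tuple x0].
have Pmax n : P n -> (n <= #|V|)%N.
  case/existsP => s /andP[us _]; rewrite -(size_tuple s) -(card_uniqP us).
  exact: max_card.
case: (ex_maxnP P1 Pmax) => m /existsP[[s /= /eqP sm] /andP[us ss]] maxm.
have longer q : uniq q -> sorted e q -> (size q <= size s)%N.
  move=> uq sq; rewrite sm; apply: maxm; apply/existsP.
  by exists (in_tuple q); rewrite /= uq sq.
case: s us ss sm longer => [|x p] us ss _ longer.
  by have := longer [:: x0] isT isT.
have nbr y : e x y -> y \in p.
  move=> exy; have yx : y != x by apply: contraTneq exy => ->; rewrite e_irr.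
  apply: contraT => yp; have := longer (y :: x :: p).
  rewrite /= inE negb_or yx yp e_sym exy ltnn; move: us ss => /= -> ->.
  by move=> /(_ isT isT).
case: p us ss {longer} nbr => [|w p] us ss nbr.
  have := e_reg x; rewrite (_ : [set y | e x y] = set0) ?cards0.
    by move=> k0; move: k2; rewrite -k0.
  by apply/setP => y; rewrite !inE; apply/negbTE/negP => /nbr.
(* Since the degree is at least 2, [x] has a neighbour [z] other than its successor [w]. As [z] lies
   further along the path, the initial segment up to [z] closes into a cycle. *)
have : (0 < #|[set y | e x y] :\ w|)%N.
  move: k2; rewrite -(e_reg x) (cardsD1 w).
  by case: (w \in _) => //= /ltnW.
case/card_gt0P => z; rewrite !inE => /andP[zw exz].
have := nbr z exz; rewrite inE (negPf zw) /= => zp.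
case/splitPr: zp us ss nbr => p1 p2 us ss nbr.
exists (x :: w :: rcons p1 z); split; last by rewrite /= size_rcons.
rewrite -cat_rcons in us ss; apply/andP; split.
  move: ss; rewrite /= cat_path !rcons_path last_rcons (e_sym z) exz andbT.
  by case/and3P => -> -> _.
by move: us; rewrite -!cat_cons cat_uniq => /andP[].
Qed.

(** Tuples of a fixed length form a finite type, so having a cycle of length [n] is a boolean
    property of [n] and a least such length can be chosen. *)
Lemma is_girth_exists s : graph_cycle e s -> exists g, is_girth e g.
Proof.
pose P n := [exists q : n.-tuple V, ucycleb e q && (2 < n)%N].
have PP q : graph_cycle e q -> P (size q).
  case=> uq sq; apply/existsP; exists (in_tuple q); rewrite /= sq andbT.
  exact: uq.
move=> /PP Ps; have exP : exists n, P n by exists (size s).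
case: (ex_minnP exP) => g /existsP[q /andP[uq sq]] min_g.
exists g; split; last by move=> r /PP /min_g.
by exists (tval q); rewrite ?size_tuple //; split; rewrite ?size_tuple.
Qed.

End Cycles.

(** * The linear programming bound *)

(** [D] lists the spectrum with multiplicity, and [I] omits the single occurrences of [k] and [-k].
    The last clause makes every [tau j] with [j != ord0] occur in the remaining sum, as the equality
    case requires. *)
Lemma trace_eval_spectrum (R : realType) (k : nat) (V : finType) (e : rel V)
    (d : nat) (tau : 'I_d.+1 -> R) :
  (0 < k)%N -> symmetric e -> connected_graph e -> regular_graph e k ->
  injective tau -> (forall i, 0 <= tau i) -> tau ord0 = k%:R ->
  (forall a : R,
    eigenvalue (adjacency_mx e R) a <-> exists i, a = tau i \/ a = - tau i) ->
  exists (D : 'I_#|V| -> R) (I : {set 'I_#|V|}),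
    [/\ forall p, \tr (eval_mx (p \Po 'X^2) (adjacency_mx e R)) =
          2 * p.[k%:R ^+ 2] + \sum_(i in I) p.[D i ^+ 2],
        forall i, i \in I -> exists2 j, j != ord0 & D i ^+ 2 = tau j ^+ 2 &
        forall j, j != ord0 -> exists2 i, i \in I & D i = tau j].
Proof.
move=> k_gt0 e_sym e_conn e_reg tau_inj tau_ge0 tau0 tau_spec.
have A_sym : (adjacency_mx e R)^T = adjacency_mx e R.
  by apply/matrixP => i j; rewrite !mxE e_sym.
have [D [trD multD]] := symmetric_mx_spectrum A_sym.
have specD a : eigenvalue (adjacency_mx e R) a <-> exists i, D i = a.
  rewrite /eigenvalue -mxrank_eq0 multD -lt0n; split.
    by case/card_gt0P => i; rewrite inE => /eqP; exists i.
  by case=> i Di; apply/card_gt0P; exists i; rewrite inE Di.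
have simple s : s ^+ 2 = 1 -> (exists i, D i = s * k%:R) ->
    exists i, forall j, (D j == s * k%:R) = (j == i).
  move=> s2 [i Di]; have x0 : V := enum_val i.
  exists i => j; apply/eqP/eqP => [Dj|->//].
  have := rank_eigenspace e_sym e_reg e_conn x0 s2; rewrite multD => /card_le1P.
  move=> /(_ i); rewrite inE Di eqxx => /(_ isT j).
  by rewrite !inE Dj eqxx => /esym/eqP.
have Dk : exists i, D i = 1 * k%:R.
  by apply/specD/tau_spec; exists ord0; left; rewrite mul1r.
have DNk : exists i, D i = -1 * k%:R.
  by apply/specD/tau_spec; exists ord0; right; rewrite mulN1r tau0.
have [i1 Ei1] := simple _ (expr1n _ _) Dk.
have sN1 : (-1) ^+ 2 = 1 :> R by rewrite sqrrN expr1n.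
have [i2 Ei2] := simple _ sN1 DNk.
have D1 : D i1 = k%:R by rewrite -[RHS]mul1r; apply/eqP; rewrite Ei1.
have D2 : D i2 = - k%:R by rewrite -mulN1r; apply/eqP; rewrite Ei2.
have k0 : 0 < k%:R :> R by rewrite ltr0n.
have i21 : i2 != i1.
  apply: contraTneq k0 => E; rewrite -leNgt -oppr_ge0.
  by rewrite -D2 E D1 ler0n.
exists D, [set i | (i != i1) && (i != i2)]; split=> [p|i|j j0].
- rewrite trD (bigD1 i1) //= (bigD1 i2) //= !horner_comp !hornerE D1 D2 sqrrN.
  rewrite mulr_natl mulr2n; congr (_ + _).
  by apply: eq_big => i; rewrite ?inE // horner_comp !hornerE.
- rewrite inE => /andP[n1 n2].
  have /tau_spec[j Dj] : eigenvalue (adjacency_mx e R) (D i).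
    by apply/specD; exists i.
  exists j; last by case: Dj => ->; rewrite ?sqrrN.
  (* Index [ord0] would give [D i] the value [k] or [-k], forcing [i] to be [i1] or [i2]. *)
  apply: contraTneq n1 => j0; case: Dj; rewrite j0 tau0 => Di.
    by rewrite -Ei1 mul1r Di eqxx.
  by move: n2; rewrite -Ei2 mulN1r Di eqxx.
- have /specD[i Di] : eigenvalue (adjacency_mx e R) (tau j).
    by apply/tau_spec; exists j; left.
  exists i => //; rewrite inE; apply/andP; split; apply: contraNneq j0 => Ei.
    by apply/eqP/tau_inj; rewrite tau0 -Di Ei.
  by have := tau_ge0 j; rewrite -Di Ei D2 oppr_ge0 leNgt k0.
Qed.

Unset Implicit Arguments.

Theorem theorem3p1 (R : realType) (k : nat) (V : finType) (e : rel V)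
    (U : {set V}) (d : nat) (tau : 'I_d.+1 -> R)
    (t : nat) (c : nat -> R) (f : {poly R})
    (k_ge2 : (2 <= k)%N)
    (e_sym : symmetric e) (e_irr : irreflexive e)
    (e_conn : connected_graph e) (e_reg : regular_graph e k)
    (e_bip : bipartition e U)
    (tau_inj : injective tau) (tau_ge0 : forall i, 0 <= tau i)
    (tau0 : tau ord0 = k%:R)
    (tau_spec : forall a : R,
      eigenvalue (adjacency_mx e R) a <-> exists i, a = tau i \/ a = - tau i)
    (f_def : f = \sum_(i < t.+1) c i *: calF0 R k i)
    (f_k2 : 0 < f.[k%:R ^+ 2])
    (f_tau : forall i, i != ord0 -> f.[tau i ^+ 2] <= 0)
    (c0_gt0 : 0 < c 0%N)
    (c_ge0 : forall j, (1 <= j <= t)%N -> 0 <= c j) :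
  let N := biadjacency_mx e R U in
  let bound := 2 * f.[k%:R ^+ 2] / c 0%N in
  [/\ #|V|%:R <= bound,
      #|V|%:R = bound <->
        (forall i, i != ord0 -> f.[tau i ^+ 2] = 0) /\
        (forall j, (1 <= j <= t)%N ->
           \tr (c j *: eval_mx (calF0 R k j) (N *m N^T)) = 0 /\
           \tr (c j *: eval_mx (calF0 R k j) (N^T *m N)) = 0)
    & #|V|%:R = bound -> (forall j, (1 <= j <= t)%N -> 0 < c j) ->
        exists2 g, is_girth e g & (2 * t + 2 <= g)%N].
Proof.
move=> N bound.
pose A := adjacency_mx e R; pose cw j : R := \sum_x (nbwalks e j.*2 x x)%:R.
have k_gt0 := ltnW k_ge2.
have [D [I [trD DI tauI]]] := trace_eval_spectrum k_gt0 e_sym e_conn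
  e_reg tau_inj tau_ge0 tau0 tau_spec.
(* [tau ord0] is an eigenvalue, and a nonzero eigenvector has a nonzero coordinate, so there is a
   vertex. *)
have [x0 _] : exists x : V, x \in V.
  have /eigenvalueP[u _ /rV0Pn[a _]] : eigenvalue A (tau ord0).
    by apply/tau_spec; exists ord0; left.
  by exists (enum_val a).
have cw0 : cw 0%N = #|V|%:R.
  by rewrite /cw /= (eq_bigr (fun=> 1)) ?sumr_const // => x _; rewrite eqxx.
have cw_ge0 j : 0 <= cw j by apply: sumr_ge0.
(* The double count of the trace: walks on the left, eigenvalues on the right. *)
have trf : c 0%N * #|V|%:R + \sum_(j < t) c j.+1 * cw j.+1 =
    2 * f.[k%:R ^+ 2] + \sum_(i in I) f.[D i ^+ 2].
  rewrite -trD.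
  have -> : f \Po 'X^2 = \sum_(i < t.+1) c i *: F R k i.*2.
    rewrite f_def raddf_sum; apply: eq_bigr => i _.
    by rewrite /= comp_polyZ calF0_comp.
  have trc i : \tr (eval_mx (c i *: F R k i.*2) A) = c i * cw i.
    by rewrite eval_mxZ mxtraceZ trace_eval_F.
  rewrite eval_mx_sum raddf_sum big_ord_recl -cw0; congr (_ + _).
    exact/esym/trc.
  by apply: eq_bigr => j _; apply/esym/trc.
have walk_ge0 (j : 'I_t) : 0 <= c j.+1 * cw j.+1.
  by rewrite mulr_ge0 // c_ge0 // ltn_ord.
have f_le0 i : i \in I -> f.[D i ^+ 2] <= 0.
  by case/DI => j j0 ->; apply: f_tau.
have walks_ge0 : 0 <= \sum_(j < t) c j.+1 * cw j.+1 by apply: sumr_ge0.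
have fs_le0 : \sum_(i in I) f.[D i ^+ 2] <= 0 by apply: sumr_le0.
have trace_U j : \tr (c j *: eval_mx (calF0 R k j) (N *m N^T)) =
    c j * \sum_(x in U) (nbwalks e j.*2 x x)%:R.
  rewrite linearZ /=; congr (_ * _).
  exact: (trace_eval_biadjacency R e_sym e_reg j (erefl (~: U))).
have trace_CU j : \tr (c j *: eval_mx (calF0 R k j) (N^T *m N)) =
    c j * \sum_(x in ~: U) (nbwalks e j.*2 x x)%:R.
  have bipC : bipartition e (~: U).
    by move=> x y /e_bip; rewrite !inE; case: (x \in U); case: (y \in U).
  rewrite linearZ /=; congr (_ * _).
  rewrite -(trace_eval_biadjacency R e_sym e_reg j (esym (setCK U)) bipC) /=.
  congr (\tr (eval_mx _ _)); apply/matrixP => a b; rewrite !mxE.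
  by apply: eq_bigr => l _; rewrite !mxE e_sym [in X in _ * X]e_sym.
have cwE j : cw j = \sum_(x in U) (nbwalks e j.*2 x x)%:R +
    \sum_(x in ~: U) (nbwalks e j.*2 x x)%:R.
  by rewrite /cw (bigID (mem U)) /=; congr (_ + _); apply: eq_bigl => x; rewrite inE.
(* At equality the main terms of [trf] cancel, leaving a nonnegative sum equal to a nonpositive
   one. *)
have bound_iff : #|V|%:R = bound <->
    \sum_(j < t) c j.+1 * cw j.+1 = 0 /\ \sum_(i in I) f.[D i ^+ 2] = 0.
  rewrite /bound; split=> [E|[E1 E2]].
    move: trf; rewrite E mulrC divfK ?gt_eqF // => /addrI E'.
    split; apply/eqP; rewrite eq_le; first by rewrite {1}E' fs_le0 walks_ge0.
    by rewrite fs_le0 -E' walks_ge0.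
  by move: trf; rewrite E1 E2 !addr0 => <-; rewrite [c _ * _]mulrC mulfK // gt_eqF.
have walks_iff : \sum_(j < t) c j.+1 * cw j.+1 = 0 <->
    forall j, (1 <= j <= t)%N -> c j * cw j = 0.
  split=> [/eqP|E]; last by apply: big1 => j _; apply: E; rewrite ltn_ord.
  rewrite psumr_eq0 // => /allP E [|j] //= jt.
  exact/eqP/(E (Ordinal jt) (mem_index_enum _)).
split.
- rewrite /bound ler_pdivlMr // mulrC.
  apply: (le_trans (y := 2 * f.[k%:R ^+ 2] + \sum_(i in I) f.[D i ^+ 2])).
    by rewrite -trf lerDl.
  by rewrite gerDl.
- rewrite bound_iff walks_iff; split=> [[Ew Ef]|[Ef Ew]]; split.
  + move=> j /tauI[i iI <-]; apply/eqP.
    move: Ef => /eqP; rewrite -oppr_eq0 -sumrN psumr_eq0; last first.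
      by move=> l lI; rewrite oppr_ge0 f_le0.
    by move/allP/(_ i (mem_index_enum _)); rewrite iI oppr_eq0.
  (* The contributions of the two colour classes are nonnegative with sum zero, so each vanishes. *)
  + move=> j jt; rewrite trace_U trace_CU.
    have cj := c_ge0 j jt; have := Ew j jt.
    have sU (S : {set V}) : 0 <= c j * \sum_(x in S) (nbwalks e j.*2 x x)%:R.
      by rewrite mulr_ge0 // sumr_ge0.
    by rewrite cwE mulrDr => /eqP; rewrite paddr_eq0 // => /andP[/eqP-> /eqP->].
  + move=> j /Ew; rewrite trace_U trace_CU cwE mulrDr => -[-> ->].
    by rewrite addr0.
  + by apply: big1 => i /DI[j j0 ->]; apply: Ef.
- move=> /bound_iff[/walks_iff Ew _] c_gt0.
  (* The girth is defined only when a cycle exists; degree at least 2 provides one. *)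
  have [s0 cyc0] := exists_graph_cycle x0 k_ge2 e_sym e_irr e_reg.
  have [g g_girth] := is_girth_exists cyc0.
  exists g => //; case: g_girth => -[s cyc sg] _.
  rewrite leqNgt; apply/negP => g_lt.
  have s_even := graph_cycle_even e_bip cyc.
  have gE : g = g./2.*2 by rewrite -sg even_halfK.
  (* As [g] is even, [g < 2 * t + 2] gives [g./2 <= t], so the vanishing of walk counts reaches
     length [g]. *)
  have jt : (1 <= g./2 <= t)%N.
    move: g_lt (proj2 cyc); rewrite sg; move: g./2 gE => h ->.
    rewrite addnC -mulnS -mul2n ltn_pmul2l // ltnS => ->.
    by case: h.
  have [x] := graph_cycle_nbwalks cyc; rewrite sg gE => nb_gt0.
  have /eqP := Ew _ jt; rewrite mulf_eq0 gt_eqF ?c_gt0 //= psumr_eq0 //.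
  move/allP/(_ x (mem_index_enum _)); rewrite /= pnatr_eq0.
  by rewrite gtn_eqF.
Qed.
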